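(* Let $m,n\in\mathbb{N}$, $m\geq1$, let $f:\mathbb{R}^m\to\mathbb{R}$ be a given function, let $H\subseteq\mathbb{R}^m$ be a hyperplane of co-dimension $1$, and let $Q_H\in\mathbb{R}[x_1,\dots,x_m]$ be a polynomial with $\deg(Q_H)=1$ and $Q_H^{-1}(0)=H$. Let $P=P_1\cup P_2\subseteq\mathbb{R}^m$, where $P_1=P\cap H$ satisfies $\#P_1=N(m-1,n)$ and is generic with respect to $H$ (upon identifying $H\cong\mathbb{R}^{m-1}$ the Vandermonde matrix $V_{m-1,n}(P_1)$ is regular), and $P_2=P\setminus H$ satisfies $\#P_2=N(m,n-1)$ and is generic with respect to $(m,n-1)$ (the Vandermonde matrix $V_{m,n-1}(P_2)$ is regular). Let $Q_1,Q_2\in\mathbb{R}[x_1,\dots,x_m]$ be such that: (i) $Q_1$ has degree $\deg(Q_1)\leq n$ and solves the polynomial interpolation problem with respect to $f$ and $P_1$ on $H$; (ii) $Q_2$ has degree $\deg(Q_2)\leq n-1$ and solves the polynomial interpolation problem with respect to $\hat f:=(f-Q_1)/Q_H$ and $P_2=P\setminus H$ on $\mathbb{R}^m$. Then $Q=Q_1+Q_HQ_2$ is the uniquely determined polynomial with $\deg(Q)\leq n$ that solves the polynomial interpolation problem with respect to $f$ and $P$ on $\mathbb{R}^m$, i.e., the unique polynomial of degree at most $n$ with $Q(p)=f(p)$ for all $p\in P$.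
   Context: $N(m,n):=\binom{m+n}{m}$ is the number of monomials of degree at most $n$ in $m$ variables. For a set $P=\{p_1,\dots,p_{N(m,n)}\}\subseteq\mathbb{R}^m$ of $N(m,n)$ points, the multivariate Vandermonde matrix $V_{m,n}(P)$ is the $N(m,n)\times N(m,n)$ matrix whose $i$-th row consists of the values at $p_i$ of all monomials $x_1^{i_1}\cdots x_m^{i_m}$ with $i_1+\dots+i_m\leq n$ (in a fixed order). Hyperplanes are affine, and $H\cong\mathbb{R}^{m-1}$ is an identification by an affine isomorphism. For an affine subspace $H\subseteq\mathbb{R}^m$ (possibly $\mathbb{R}^m$ itself), a set of nodes $P\subseteq H$, a degree bound $d$ and a function $g$ (defined at least on $P$), a polynomial $Q\in\mathbb{R}[x_1,\dots,x_m]$ with $\deg(Q)\leq d$ solves the polynomial interpolation problem (PIP) with respect to $g$ and $P$ on $H$ if $Q(p)=g(p)$ for all $p\in P$, and whenever $Q'\in\mathbb{R}[x_1,\dots,x_m]$ satisfies $\deg(Q')\leq d$ and $Q'(p)=g(p)$ for all $p\in P$, then $Q'(x)=Q(x)$ for all $x\in H$. The degree bound is $n$ in (i) and $n-1$ in (ii). *)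

(* Defs.v *)
From mathcomp Require Import all_boot all_order all_algebra finmap.
From mathcomp Require Import mpoly.
From mathcomp Require Import boolp classical_sets reals.

Set Implicit Arguments.
Unset Strict Implicit.
Unset Printing Implicit Defensive.

Import Order.TTheory GRing.Theory Num.Theory.

Local Open Scope classical_set_scope.
Local Open Scope ring_scope.

(* Points of R^m are row vectors; degree bounds [d] are integers, so that the
   bound [n - 1] makes sense when [n = 0]: the zero polynomial, of degree
   minus infinity, is the only one of degree at most -1. *)

(* [strict_bound d = d + 1], truncated at 0: since [msize Q] is the degree
   plus one (and 0 for [Q = 0]), the degree of [Q] is at most [d] iff
   [msize Q <= strict_bound d]. *)
Definition strict_bound (d : int) : nat := if d is Posz k then k.+1 else 0%N.

Definition deg_le (R : realType) (m : nat) (Q : {mpoly R[m]}) (d : int) : bool :=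
  (msize Q <= strict_bound d)%N.

Definition N (m : nat) (d : int) : nat := if d is Posz k then 'C(m + k, m) else 0%N.

Definition monomials (m : nat) (d : int) : seq 'X_{1..m} :=
  [seq bmnm u | u <- enum {: 'X_{1..m < strict_bound d}}].

Definition peval (R : realType) (m : nat) (Q : {mpoly R[m]}) (x : 'rV[R]_m) : R :=
  Q.@[x 0].

(* Rows follow the internal enumeration of [P], columns that of [monomials].
   The [nth] defaults are never reached when [P] has [N m d] elements, since
   [monomials m d] has [N m d] elements as well (see [size_monomials]). *)
Definition vandermonde (R : realType) (m : nat) (d : int) (P : {fset 'rV[R]_m}) :
    'M[R]_(N m d) :=
  \matrix_(i, j)
    peval 'X_[nth 0%MM (monomials m d) j] (nth 0 (enum_fset P) i).

Definition generic (R : realType) (m : nat) (d : int) (P : {fset 'rV[R]_m}) : Prop :=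
  vandermonde d P \in unitmx.

Definition hyperplane (R : realType) (m : nat) (H : set 'rV[R]_m) : Prop :=
  exists (c : 'rV[R]_m) (V : {vspace 'rV[R]_m}),
    (\dim V + 1 = m)%N /\ H = [set x | x - c \in V].

Definition affine_iso (R : realType) (k m : nat) (phi : 'rV[R]_k -> 'rV[R]_m)
    (H : set 'rV[R]_m) : Prop :=
  [/\ exists (A : 'M[R]_(k, m)) (b : 'rV[R]_m), forall y, phi y = y *m A + b,
      injective phi
    & phi @` [set: 'rV[R]_k] = H].

(* [S] is the copy of [P] in R^(m-1). Regularity of its Vandermonde matrix does
   not depend on [phi], because affine changes of coordinates preserve the
   degree. *)
Definition generic_on (R : realType) (m : nat) (d : int) (H : set 'rV[R]_m)
    (P : {fset 'rV[R]_m}) : Prop :=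
  exists (phi : 'rV[R]_(m.-1) -> 'rV[R]_m) (S : {fset 'rV[R]_(m.-1)}),
    [/\ affine_iso phi H, [fset phi y | y in S]%fset = P & generic d S].

Definition interpolates (R : realType) (m : nat) (P : {fset 'rV[R]_m})
    (g : 'rV[R]_m -> R) (Q : {mpoly R[m]}) : Prop :=
  forall p, p \in P -> peval Q p = g p.

Definition solves_PIP (R : realType) (m : nat) (d : int) (g : 'rV[R]_m -> R)
    (P : {fset 'rV[R]_m}) (H : set 'rV[R]_m) (Q : {mpoly R[m]}) : Prop :=
  [/\ deg_le Q d, interpolates P g Q
    & forall Q' : {mpoly R[m]}, deg_le Q' d -> interpolates P g Q' ->
        forall x, H x -> peval Q' x = peval Q x].

Lemma mem_monomials (m : nat) (d : int) (u : 'X_{1..m}) :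
  (u \in monomials m d) = (mdeg u < strict_bound d)%N.
Proof.
apply/mapP/idP => [[v _ ->]|ud]; first exact: bmdeg.
by exists (BMultinom ud); rewrite ?mem_enum.
Qed.

Lemma uniq_monomials (m : nat) (d : int) : uniq (monomials m d).
Proof. by rewrite map_inj_uniq ?enum_uniq //; exact: val_inj. Qed.

Lemma size_monomials (m : nat) (d : int) : size (monomials m d) = N m d.
Proof.
case: d => [k|k]; last first.
  rewrite /N; apply/eqP; rewrite size_eq0; case E: monomials => [//|u s].
  by have := mem_monomials (Negz k) u; rewrite E inE eqxx.
case: m => [|m] /=.
  rewrite bin0 (perm_size (s2 := [:: 0%MM])) //.
  apply: uniq_perm => // [|u]; first exact: uniq_monomials.
  have -> : u = 0%MM by apply/mnmP => -[].
  by rewrite mem_monomials mdeg0 !inE eqxx.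
pose sb d := [seq s2m t | t : d.-tuple 'I_m.+1 <- enum (basis m.+1 d)].
have sb_disj (s : seq 'X_{1..m.+1}) (j : nat) :
    uniq s -> (forall u, u \in s = (mdeg u < j)%N) ->
    uniq (s ++ sb j) /\ (forall u, u \in s ++ sb j = (mdeg u < j.+1)%N).
  move=> us ms; split=> [|u].
    rewrite cat_uniq us uniq_basis andbT /=; apply/hasPn => u.
    by rewrite -basis_cover => /eqP du; rewrite ms du ltnn.
  by rewrite mem_cat ms -basis_cover ltnS [RHS]leq_eqVlt orbC.
elim: k => [|k IHk].
  have [us ms] := sb_disj [::] 0%N isT (fun=> erefl).
  rewrite (perm_size (s2 := [::] ++ sb 0%N)) ?size_basis /= ?addn0 ?binn ?bin0 //.
  by apply: uniq_perm => // [|u]; rewrite ?uniq_monomials // mem_monomials ms.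
have [us ms] := sb_disj _ k.+1 (uniq_monomials _ k) (@mem_monomials m.+1 k).
rewrite (perm_size (s2 := monomials m.+1 k ++ sb k.+1)); last first.
  by apply: uniq_perm => // [|u]; rewrite ?uniq_monomials // mem_monomials ms.
rewrite size_cat IHk size_basis /N addnS binS.
rewrite addSnnS -(bin_sub (leq_addr k.+1 m)) addKn.
by rewrite [(k.+1 + m)%N]addnC.
Qed.

(* Main.v *)
Require Import Defs.
From mathcomp Require Import all_boot all_order all_algebra finmap.
From mathcomp Require Import mpoly.
From mathcomp Require Import boolp classical_sets reals.

Import Order.TTheory GRing.Theory Num.Theory.

Local Open Scope classical_set_scope.
Local Open Scope ring_scope.

(** Any interpolant [Q] of degree at most [n] agrees with [Q1] on [H], by the
    uniqueness part of the problem on [H]. A polynomial vanishing on the zero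
    set of [QH], which has degree 1, is a multiple of [QH]: if [X_j] occurs in
    [QH] with coefficient [c], then substituting [X_j - QH / c] for [X_j] does
    not change the polynomial modulo [QH], and turns it into a polynomial that
    vanishes everywhere. Hence [Q - Q1 = QH * G], where [G] solves the problem
    that determines [Q2]. *)

(** Splitting off the last exponent loses no information about a monomial, so [p] can be recovered
    from the coefficients of [muni p]. This is what turns [muni p = 0] into [p = 0]. *)
Lemma mcoeff_muni (n : nat) (R : nzRingType) (p : {mpoly R[n.+1]})
    (k : 'X_{1..n.+1}) :
  ((muni p)`_(k ord_max))@_[multinom k (widen_ord (leqnSn n) i) | i < n] = p@_k.
Proof.
rewrite muniE coef_sum raddf_sum /= [in RHS](mpolyE p) raddf_sum /=.
apply: eq_bigr => u _.
rewrite coefZ coefXn mulr_natr mcoeffMn !mcoeffZ !mcoeffX.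
rewrite -mulrnAr -mulrnA mulnb; congr (_ * (nat_of_bool _)%:R).
apply/andP/eqP => [[/eqP/mnmP uk /eqP mk]|-> //]; apply/mnmP => i.
have [->//|im] := eqVneq i ord_max.
have i_lt : (i < n)%N by rewrite ltn_neqAle im -ltnS ltn_ord.
have -> : i = widen_ord (leqnSn n) (Ordinal i_lt) by apply: val_inj.
by have := uk (Ordinal i_lt); rewrite !mnmE.
Qed.

Lemma horner_muni (n : nat) (R : comNzRingType) (p : {mpoly R[n.+1]})
    (v : 'I_n.+1 -> R) :
  (map_poly (meval (fun i => v (widen_ord (leqnSn n) i))) (muni p)).[v ord_max]
  = p.@[v].
Proof.
rewrite muniE rmorph_sum horner_sum mevalE /=; apply: eq_bigr => k _.
rewrite map_polyZ map_polyXn hornerZ hornerXn /= mevalZ mevalX big_ord_recr /=.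
by rewrite mulrA; under eq_bigr do rewrite mnmE.
Qed.

(** In characteristic zero the integers from 0 to [size q - 1] are pairwise distinct roots, too many
    for a nonzero [q]. *)
Lemma poly_eq0_horner (R : numDomainType) (q : {poly R}) :
  (forall t, q.[t] = 0) -> q = 0.
Proof.
move=> q0; apply: (@roots_geq_poly_eq0 _ _ [seq i%:R | i <- iota 0 (size q)]).
- by apply/allP => t _; rewrite /root q0.
- by rewrite map_inj_uniq ?iota_uniq // => i j /eqP; rewrite eqr_nat => /eqP.
- by rewrite size_map size_iota.
Qed.

(** Induction on the number of variables: with the first [n] coordinates fixed, the univariate
    polynomial in the last one vanishes everywhere. Its coefficients therefore vanish at every point
    of the first [n] coordinates and fall under the induction hypothesis. *)
Lemma meval_eq0 (R : numDomainType) (n : nat) (p : {mpoly R[n]}) :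
  (forall v, p.@[v] = 0) -> p = 0.
Proof.
elim: n p => [|n IHn] p p0.
  (* Without variables every monomial has degree 0, so [p] is constant. *)
  have p1 : (msize p <= 1)%N.
    by rewrite msizeE; apply/bigmax_leqP_seq => k _ _; rewrite mdegE big_ord0.
  by have := p0 (fun=> 0); rewrite (msize1_polyC p1) mevalC => ->.
have muni_p0 : muni p = 0.
  apply/polyP => j; rewrite coef0; apply: IHn => v.
  rewrite -coef_map /= (_ : map_poly _ _ = 0) ?coef0 //.
  apply: poly_eq0_horner => t.
  (* The point with last coordinate [t] and remaining coordinates [v]. *)
  rewrite -(p0 (fun i => if unlift ord_max i is Some j then v j else t)).
  rewrite -horner_muni unlift_none; congr (_.[_]); apply: eq_map_poly => q.
  apply: meval_eq => i; rewrite (_ : widen_ord _ i = lift ord_max i) ?liftK //.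
  by apply: val_inj; rewrite /= /bump leqNgt ltn_ord.
by apply/mpolyP => k; rewrite -mcoeff_muni muni_p0 coef0 !mcoeff0.
Qed.

Lemma msize2E (R : nzRingType) (n : nat) (p : {mpoly R[n]}) :
  (msize p <= 2)%N -> p = (p@_0%MM)%:MP + \sum_(i < n) p@_U_(i) *: 'X_i.
Proof.
move=> p2; apply/mpolyP => k; rewrite mcoeffD mcoeffC raddf_sum /=.
under eq_bigr do rewrite mcoeffZ mcoeffX.
case: (ltnP 1 (mdeg k)) => [k2|].
  rewrite memN_msupp_eq0 ?msize_mdeg_ge ?(leq_trans p2) // big1 => [|i _].
    by rewrite -mdeg_eq0 -leqn0 leqNgt (ltnW k2) mulr0 addr0.
  have [ik|] := eqVneq; last by rewrite mulr0.
  by rewrite -ik mdeg1 in k2.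
rewrite leq_eqVlt ltnS leqn0 mdeg_eq0 => /orP[/mdeg1P[j /eqP ->]|/eqP ->].
  rewrite (bigD1 j) //= eqxx mulr1 big1 => [|i ij].
    by rewrite -mdeg_eq0 mdeg1 mulr0 add0r addr0.
  by rewrite eq_mnm1 (negbTE ij) mulr0.
rewrite eqxx mulr1 big1 ?addr0 // => i _.
by rewrite -mdeg_eq0 mdeg1 mulr0.
Qed.

(** Congruence modulo [L], written [C] below, is compatible with sums and products, hence with
    substitution into a polynomial. *)
Lemma comp_mpoly_congr (R : comNzRingType) (n k : nat) (p : {mpoly R[n]})
    (a b : n.-tuple {mpoly R[k]}) (L : {mpoly R[k]}) :
  (forall i, exists G, tnth a i - tnth b i = L * G) ->
  exists G, (p \mPo a) - (p \mPo b) = L * G.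
Proof.
move=> ab; pose C x y := exists G : {mpoly R[k]}, x - y = L * G.
have C0 x : C x x by exists 0; rewrite subrr mulr0.
have CM x y z t : C x y -> C z t -> C (x * z) (y * t).
  (* The witness comes from [x * z - y * t = (x - y) * z + y * (z - t)]. *)
  move=> [G xy] [K zt]; exists (G * z + y * K).
  by rewrite mulrDr mulrA -xy mulrCA -zt mulrBl mulrBr addrA subrK.
have CD x y z t : C x y -> C z t -> C (x + z) (y + t).
  by move=> [G xy] [K zt]; exists (G + K); rewrite mulrDr -xy -zt opprD addrACA.
rewrite -/(C _ _) !comp_mpolyEX; apply: big_ind2 => [||m _].
- exact: C0.
- exact: CD.
rewrite -!mul_mpolyC !comp_mpolyX; apply: (CM) => //; apply: big_ind2 => [||i _].
- exact: C0.
- exact: CM.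
elim: (m i) => [|e IHe]; first by rewrite !expr0.
by rewrite !exprS; apply: (CM).
Qed.

Lemma linear_factor (R : numFieldType) (n : nat) (L p : {mpoly R[n]}) :
  msize L = 2%N -> (forall v, L.@[v] = 0 -> p.@[v] = 0) ->
  exists G, p = L * G.
Proof.
move=> L2 Lp; have LE := msize2E _ _ _ (eq_leq L2).
(* If all linear coefficients were zero, [L] would be constant, of [msize] at most 1. *)
have [j cj] : exists j, L@_U_(j) != 0.
  apply/existsP; apply: contra_eqT L2 => /existsPn L0.
  rewrite LE big1 => [|i _]; last first.
    by have := L0 i; rewrite negbK => /eqP->; rewrite scale0r.
  by rewrite addr0 msizeC; case: (L@_0%MM == 0).
pose c := L@_U_(j); pose a := [tuple 'X_i | i < n] : n.-tuple {mpoly R[n]}.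
pose b : n.-tuple {mpoly R[n]} :=
  [tuple 'X_i - (i == j)%:R *: (c^-1 *: L) | i < n].
have [i|G pG] := @comp_mpoly_congr _ _ _ p a b L.
  exists ((i == j)%:R * c^-1)%:MP.
  by rewrite !tnth_mktuple opprB addrC subrK scalerA [RHS]mulrC mul_mpolyC.
exists G; rewrite -pG comp_mpoly_id [X in _ - X](_ : _ = 0) ?subr0 //.
apply: meval_eq0 => v; rewrite comp_mpoly_meval; apply: Lp.
have evL w : L.@[w] = L@_0%MM + \sum_(i < n) L@_U_(i) * w i.
  rewrite {1}LE mevalD mevalC raddf_sum /=; congr (_ + _).
  by apply: eq_bigr => i _; rewrite mevalZ mevalXU.
(* Only the [j]-th coordinate is moved, which changes the value of [L] by [- c * (c^-1 * L.@[v])];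
   the moved point thus lies on the zero set of [L]. *)
rewrite evL; under eq_bigr do
  rewrite tnth_mktuple mevalB mevalXU !mevalZ mulrBr.
rewrite sumrB addrA -evL (bigD1 j) //= eqxx mul1r mulVKf // big1 ?addr0 ?subrr //.
by move=> i /negbTE ->; rewrite mul0r mulr0.
Qed.

Lemma deg_leB1 (R : realType) (m n : nat) (Q : {mpoly R[m]}) :
  deg_le Q (n%:Z - 1) = (msize Q <= n)%N.
Proof. by case: n => [|n] //; rewrite /deg_le -addn1 PoszD addrK addn1. Qed.

(** Over a domain, multiplying a nonzero [G] by [L] raises [msize] by exactly one; [G = 0] meets
    both bounds. Being an equality, this bounds the quotient [G] as well as the product
    [QH * Q2]. *)
Lemma deg_leB1_mul (R : realType) (m n : nat) (L G : {mpoly R[m]}) :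
  msize L = 2%N -> deg_le (L * G) n = deg_le G (n%:Z - 1).
Proof.
move=> L2; rewrite deg_leB1 /deg_le /=.
have [->|G0] := eqVneq G 0; first by rewrite mulr0 msize0.
by rewrite msizeM // ?L2 // -msize_poly_eq0 L2.
Qed.

Lemma deg_leD (R : realType) (m : nat) (d : int) (p q : {mpoly R[m]}) :
  deg_le p d -> deg_le q d -> deg_le (p + q) d.
Proof.
by move=> pd qd; apply: leq_trans (msizeD_le _ _) _; rewrite geq_max; apply/andP.
Qed.

Lemma deg_leN (R : realType) (m : nat) (d : int) (p : {mpoly R[m]}) :
  deg_le (- p) d = deg_le p d.
Proof. by rewrite /deg_le msizeN. Qed.

Lemma peval_inj (R : realType) (m : nat) (p q : {mpoly R[m]}) :
  (forall x, peval p x = peval q x) -> p = q.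
Proof.
move=> pq; apply/eqP; rewrite -subr_eq0; apply/eqP/meval_eq0 => v.
have := pq (\row_i v i); rewrite /peval => /eqP; rewrite -subr_eq0 -mevalB.
by move=> /eqP <-; apply: meval_eq => i; rewrite mxE.
Qed.

Theorem theorem7p4 (R : realType) (m n : nat) (hm : (1 <= m)%N)
    (f : 'rV[R]_m -> R) (H : set 'rV[R]_m) (hH : hyperplane H)
    (QH : {mpoly R[m]}) (degQH : msize QH = 2%N)
    (zeroQH : peval QH @^-1` [set 0] = H)
    (P P1 P2 : {fset 'rV[R]_m}) (hP : P = (P1 `|` P2)%fset)
    (hP1 : P1 = [fset p in P | p \in H]%fset)
    (hP2 : P2 = [fset p in P | p \notin H]%fset)
    (cardP1 : #|` P1| = N m.-1 n) (genP1 : generic_on n H P1)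
    (cardP2 : #|` P2| = N m (n%:Z - 1)) (genP2 : generic (n%:Z - 1) P2)
    (Q1 Q2 : {mpoly R[m]})
    (solQ1 : solves_PIP n f P1 H Q1)
    (solQ2 : solves_PIP (n%:Z - 1)
       (fun x => (f x - peval Q1 x) / peval QH x) P2 [set: 'rV[R]_m] Q2) :
  solves_PIP n f P [set: 'rV[R]_m] (Q1 + QH * Q2) /\
  (forall Q : {mpoly R[m]}, deg_le Q n -> interpolates P f Q ->
     Q = Q1 + QH * Q2).
Proof.
have HE x : H x <-> peval QH x = 0 by rewrite -zeroQH.
have QH1 p : p \in P1 -> peval QH p = 0.
  by rewrite hP1 !inE => /andP[_ /set_mem /HE].
have QH2 p : p \in P2 -> peval QH p != 0.
  by rewrite hP2 !inE => /andP[_ pH]; apply: contraNneq pH => /HE /mem_set.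
have pevalDM p : peval (Q1 + QH * Q2) p = peval Q1 p + peval QH p * peval Q2 p.
  by rewrite /peval mevalD mevalM.
have [degQ1 interQ1 uniqQ1] := solQ1.
have [degQ2 interQ2 uniqQ2] := solQ2.
(* Proved first, as it also supplies the uniqueness clause of [solves_PIP]. *)
have uniqQ (Q : {mpoly R[m]}) :
    deg_le Q n -> interpolates P f Q -> Q = Q1 + QH * Q2.
  move=> degQ interQ.
  have QQ1 : forall v, QH.@[v] = 0 -> (Q - Q1).@[v] = 0.
    move=> v v0; have vE (p : {mpoly R[m]}) : p.@[v] = peval p (\row_i v i).
      by apply: meval_eq => i; rewrite mxE.
    apply/eqP; rewrite mevalB subr_eq0 !vE; apply/eqP/uniqQ1 => //.
      by move=> p pP1; apply: interQ; rewrite hP inE pP1.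
    by apply/HE; rewrite -vE.
  have [G QG] := linear_factor _ _ _ _ degQH QQ1.
  suff <- : G = Q2 by rewrite -QG addrC subrK.
  apply: peval_inj => x; apply: uniqQ2 => // [|p pP2].
    by rewrite -(deg_leB1_mul _ _ _ _ _ degQH) -QG deg_leD ?deg_leN.
  (* On [P2] the value of [QH] is nonzero, so [Q - Q1 = QH * G] can be divided by it. *)
  rewrite -(interQ p) ?hP ?inE ?pP2 ?orbT // -mevalB QG mevalM.
  by rewrite -/(peval QH p) mulrAC divff ?mul1r // QH2.
split=> //; split=> [|p|Q degQ interQ x _]; last by rewrite -(uniqQ Q).
  by rewrite deg_leD ?deg_leB1_mul.
(* On [P1] the second summand vanishes with [QH]; on [P2] the factor [QH] cancels the denominator
   and leaves [f - Q1]. *)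
rewrite hP inE pevalDM => /orP[pP1|pP2].
  by rewrite QH1 // mul0r addr0 interQ1.
by rewrite interQ2 // mulrC divfK ?QH2 // addrC subrK.
Qed.
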